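(* Let $M$ be a matrix with positive entries. If $M$ is on the boundary of $\mathcal{M}_{\binom{k+1}{2},k}^{p\times q}$, then in any size-$k$ psd factorization of $M$ at least one factor has rank smaller than $k$.
   Context: A size-$k$ psd factorization of a nonnegative $p\times q$ matrix $M$ is a tuple $A^{(1)},\dots,A^{(p)},B^{(1)},\dots,B^{(q)}$ (the factors) of real symmetric positive semidefinite $k\times k$ matrices with $M_{ij}=\operatorname{trace}(A^{(i)}B^{(j)})$; the psd rank of $M$ is the smallest such $k$. $\mathcal{M}_{\binom{k+1}{2},k}^{p\times q}$ is the set of nonnegative $p\times q$ matrices of rank $\binom{k+1}{2}$ and psd rank $k$. Its boundary is its topological boundary inside the space of all real $p\times q$ matrices of rank $\binom{k+1}{2}$ (with the Euclidean subspace topology). *)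

(* Defs.v *)
From mathcomp Require Import all_boot all_order all_algebra.
From mathcomp Require Import all_classical all_reals all_analysis.

Set Implicit Arguments.
Unset Strict Implicit.
Unset Printing Implicit Defensive.

Import Order.TTheory GRing.Theory Num.Theory.
Import numFieldNormedType.Exports.

Local Open Scope classical_set_scope.
Local Open Scope ring_scope.

Definition psdmx (R : realType) (k : nat) (A : 'M[R]_k) : Prop :=
  A^T = A /\ forall x : 'cV[R]_k, 0 <= (x^T *m A *m x) ord0 ord0.

Definition psd_factorization (R : realType) (p q : nat) (M : 'M[R]_(p, q))
    (k : nat) (A : 'I_p -> 'M[R]_k) (B : 'I_q -> 'M[R]_k) : Prop :=
  [/\ forall i, psdmx (A i),
      forall j, psdmx (B j) &
      forall i j, M i j = \tr (A i *m B j)].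

Definition has_psd_factorization (R : realType) (p q : nat)
    (M : 'M[R]_(p, q)) (k : nat) : Prop :=
  exists (A : 'I_p -> 'M[R]_k) (B : 'I_q -> 'M[R]_k), psd_factorization M A B.

Definition is_psd_rank (R : realType) (p q : nat) (M : 'M[R]_(p, q))
    (k : nat) : Prop :=
  has_psd_factorization M k /\
  forall m : nat, has_psd_factorization M m -> (k <= m)%N.

Definition nonneg_mx (R : realType) (p q : nat) (M : 'M[R]_(p, q)) : Prop :=
  forall i j, 0 <= M i j.

Definition rank_set (R : realType) (p q r : nat) : set 'M[R]_(p, q) :=
  [set M | \rank M = r].

Definition psd_rank_set (R : realType) (p q r k : nat) : set 'M[R]_(p, q) :=
  [set M | [/\ nonneg_mx M, \rank M = r & is_psd_rank M k]].

Definition boundary (T : topologicalType) (S : set T) : set T :=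
  closure S `\` S°.

(* [subspace X] has carrier [T]; its topology is the subspace topology on [X],
   with every point outside [X] isolated. Such points belong to no boundary,
   so this is the boundary of [S `&` X] in the topological space [X]. *)
Definition boundary_within (T : topologicalType) (X S : set T) : set T :=
  @boundary (subspace X) S.

Arguments rank_set R p q r : clear implicits.
Arguments psd_rank_set R p q r k : clear implicits.

(* Main.v *)
Require Import Defs.
From mathcomp Require Import all_boot all_order all_algebra.
From mathcomp Require Import all_classical all_reals all_analysis.
From mathcomp Require Import ring lra.

Set Implicit Arguments.
Unset Strict Implicit.
Unset Printing Implicit Defensive.

Import Order.TTheory GRing.Theory Num.Theory.
Import numFieldNormedType.Exports.

Local Open Scope classical_set_scope.
Local Open Scope ring_scope.

(** A positive matrix M of rank r = 'C(k+1, 2) all of whose size-k factors are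
    invertible is an interior point, because its factorization can be moved
    continuously along with M.

    Symmetric k x k matrices form a space of dimension r on which the trace
    form has a Gram matrix G.  Writing the factors in coordinates turns the
    factorization into M = U G V^T, with r columns in U and V
    ([psd_factorization_gramE]).  Since r is also the rank of M, nothing is lost
    in this product: U has a left inverse D, G V^T has a right inverse C, and G
    is invertible.  Any N of rank r with D N C invertible is recovered from its
    products with C and D: N = (N C) (D N C)^-1 (D N) ([mx_rank_sandwich]).
    Reading N C as new coordinates of the first factors, and G^-1 (D N C)^-1 D N
    as those of the second ones, gives a factorization of N by symmetric
    matrices which depends continuously on N and equals the given one at
    N = M.  The given factors are positive definite, and positive
    definiteness is an open condition on symmetric matrices ([near_psdmx]); so
    the factors of N are psd for N near M ([near_has_psd_factorization]).

    No smaller factorization of N can exist, since a size-m one forces the rank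
    to be at most 'C(m+1, 2) ([psd_factorization_rank]). *)

(** * Continuity of matrix operations *)

Section MatrixLimits.
Context {R : realType} {T : Type} {F : set_system T} {FF : Filter F}.

(** The topology on matrices is generated by products of entrywise
    neighbourhoods, finitely many of which can be intersected. *)
Lemma cvg_mx m n (f : T -> 'M[R]_(m, n)) (L : 'M[R]_(m, n)) :
  (forall i j, f x i j @[x --> F] --> L i j) -> f @ F --> L.
Proof.
move=> fL U [P /= PL PU]; rewrite /= /nbhs /=.
have : \forall x \near F, forall i j, P i j (f x i j).
  apply: filter_forall => i; apply: filter_forall => j.
  exact: (fL i j _ (PL i j)).
by apply: filterS => x Px; exact: PU.
Qed.

Lemma cvg_entry m n (f : T -> 'M[R]_(m, n)) (L : 'M[R]_(m, n)) i j :
  f @ F --> L -> f x i j @[x --> F] --> L i j.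
Proof.
move=> fL.
apply: (@cvg_comp _ _ _ f (fun N : 'M[R]_(m, n) => N i j) F (nbhs L)) => //.
exact: coord_continuous.
Qed.

Lemma cvg_sum_fin (I : Type) (r : seq I) (f : I -> T -> R) (l : I -> R) :
  (forall i, f i @ F --> l i) ->
  \sum_(i <- r) f i x @[x --> F] --> \sum_(i <- r) l i.
Proof.
move=> fl; elim: r => [|i r IH].
  by rewrite big_nil; under eq_fun do rewrite big_nil; exact: cvg_cst.
by rewrite big_cons; under eq_fun do rewrite big_cons; exact: cvgD.
Qed.

Lemma cvg_prod_fin (I : Type) (r : seq I) (f : I -> T -> R) (l : I -> R) :
  (forall i, f i @ F --> l i) ->
  \prod_(i <- r) f i x @[x --> F] --> \prod_(i <- r) l i.
Proof.
move=> fl; elim: r => [|i r IH].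
  by rewrite big_nil; under eq_fun do rewrite big_nil; exact: cvg_cst.
by rewrite big_cons; under eq_fun do rewrite big_cons; exact: cvgM.
Qed.

Lemma cvg_mulmx m n p (f : T -> 'M[R]_(m, n)) (g : T -> 'M[R]_(n, p))
    (K : 'M[R]_(m, n)) (L : 'M[R]_(n, p)) :
  f @ F --> K -> g @ F --> L -> f x *m g x @[x --> F] --> K *m L.
Proof.
move=> fK gL; apply: cvg_mx => i j; rewrite mxE; under eq_fun do rewrite mxE.
by apply: cvg_sum_fin => l; apply: cvgM; exact: cvg_entry.
Qed.

Lemma cvg_trmx m n (f : T -> 'M[R]_(m, n)) (L : 'M[R]_(m, n)) :
  f @ F --> L -> (f x)^T @[x --> F] --> L^T.
Proof.
move=> fL; apply: cvg_mx => i j; rewrite mxE; under eq_fun do rewrite mxE.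
exact: cvg_entry.
Qed.

Lemma cvg_det n (f : T -> 'M[R]_n) (L : 'M[R]_n) :
  f @ F --> L -> \det (f x) @[x --> F] --> \det L.
Proof.
move=> fL; apply: cvg_sum_fin => s; apply: cvgM; first exact: cvg_cst.
by apply: cvg_prod_fin => i; exact: cvg_entry.
Qed.

Lemma cvg_adj n (f : T -> 'M[R]_n) (L : 'M[R]_n) :
  f @ F --> L -> \adj (f x) @[x --> F] --> \adj L.
Proof.
move=> fL; apply: cvg_mx => i j; rewrite mxE; under eq_fun do rewrite mxE.
rewrite /cofactor; apply: cvgM; first exact: cvg_cst.
apply: cvg_det; apply: cvg_mx => a b; rewrite !mxE.
under eq_fun do rewrite !mxE.
exact: cvg_entry.
Qed.

Lemma near_unitmx n (f : T -> 'M[R]_n) (L : 'M[R]_n) :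
  f @ F --> L -> L \in unitmx -> \forall x \near F, f x \in unitmx.
Proof.
move=> /cvg_det fL; rewrite unitmxE unitfE => L0.
apply: filterS (@cvgr_neq0 _ R^o _ F _ (fun x => \det (f x)) _ fL L0) => x.
by rewrite unitmxE unitfE.
Qed.

(** By Cramer's rule the inverse is a rational function of the entries, whose
    denominator, the determinant, does not vanish at the limit. *)
Lemma cvg_invmx n (f : T -> 'M[R]_n) (L : 'M[R]_n) :
  f @ F --> L -> L \in unitmx -> invmx (f x) @[x --> F] --> invmx L.
Proof.
move=> fL Lu.
suff inv_adj : (\det (f x))^-1 *: \adj (f x) @[x --> F] --> invmx L.
  apply: cvg_trans inv_adj; apply: near_eq_cvg.
  by have := near_unitmx fL Lu; apply: filterS => x fx; rewrite /invmx fx.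
rewrite /invmx Lu; apply: cvg_mx => i j; rewrite mxE.
under eq_fun do rewrite mxE.
apply: cvgM; last by apply: cvg_entry; exact: cvg_adj.
by apply: cvgV; [rewrite -unitfE -unitmxE | exact: cvg_det].
Qed.

End MatrixLimits.

(** * Openness of positive definiteness *)

Lemma quad_formE (R : realType) k (A : 'M[R]_k) (x : 'cV[R]_k) :
  (x^T *m A *m x) ord0 ord0 = \sum_i \sum_j x i ord0 * A i j * x j ord0.
Proof.
rewrite mxE exchange_big /=; apply: eq_bigr => j _.
by rewrite mxE mulr_suml; apply: eq_bigr => i _; rewrite mxE.
Qed.

(** A psd form with invertible matrix is bounded below by a multiple of the
    squared Euclidean norm.  Compactness of the sphere is avoided: if
    A y = e_i, then x_i is the A-inner product of x and y, so the Cauchy-Schwarz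
    inequality for A bounds x_i^2 by a constant times x^T A x. *)
Lemma psdmx_coercive (R : realType) k (A : 'M[R]_k) :
  psdmx A -> A \in unitmx ->
  exists2 s : R, 0 < s &
    forall x : 'cV[R]_k,
      s * \sum_i x i ord0 ^+ 2 <= (x^T *m A *m x) ord0 ord0.
Proof.
move=> [As Ap] Au.
have coord_bound i : exists2 s : R, 0 < s & forall x : 'cV[R]_k,
    s * x i ord0 ^+ 2 <= (x^T *m A *m x) ord0 ord0.
  have [y Ay] : exists y : 'cV[R]_k, A *m y = delta_mx i ord0.
    by exists (invmx A *m delta_mx i ord0); rewrite mulKVmx.
  pose c := (y^T *m A *m y) ord0 ord0.
  have c0 : 0 <= c by exact: Ap.
  exists (1 + c)^-1 => [|x]; first by rewrite invr_gt0 ltr_pwDl.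
  set Q := (X in _ <= X); set s := _^-1.
  have s0 : 0 < s by rewrite invr_gt0 ltr_pwDl.
  have sc : s * (1 + c) = 1 by rewrite mulVf// gt_eqF// ltr_pwDl.
  have xAy : x^T *m A *m y = (x i ord0)%:M.
    rewrite -mulmxA Ay -colE; apply/matrixP => a b.
    by rewrite !ord1 !mxE eqxx mulr1n.
  have yAx : y^T *m A *m x = (x i ord0)%:M.
    by apply: trmx_inj; rewrite !trmx_mul trmxK As mulmxA xAy tr_scalar_mx.
  have tr_shift : (x - (s * x i ord0) *: y)^T = x^T - (s * x i ord0) *: y^T.
    by apply/matrixP => a b; rewrite !mxE.
  (* Cauchy-Schwarz: positivity at x - t y, with t = s x_i close enough to the
     minimizer x_i / c and meaningful even if c = 0. *)
  have := Ap (x - (s * x i ord0) *: y); rewrite tr_shift.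
  rewrite !mulmxBl !mulmxBr -!scalemxAl -!scalemxAr.
  rewrite xAy yAx; set X := x i ord0.
  have -> P S : (P - (s * X) *: X%:M - ((s * X) *: X%:M -
      (s * X) *: ((s * X) *: S))) ord0 ord0 =
      P ord0 ord0 - 2 * (s * X ^+ 2) + (s * X) ^+ 2 * S ord0 ord0 :> R.
    by rewrite !mxE /= !mulr1n; ring.
  rewrite -/Q -/c.
  have sX : 0 <= s * X ^+ 2 by rewrite mulr_ge0 ?sqr_ge0 ?ltW.
  have -> : (s * X) ^+ 2 * c = (s * (1 + c)) * (s * X ^+ 2) - s * (s * X ^+ 2).
    by ring.
  rewrite sc; have : 0 <= s * (s * X ^+ 2) by rewrite mulr_ge0// ltW.
  nra.
have [s s0 sP] := fin_all_exists2 coord_bound.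
pose S := 1 + \sum_i (s i)^-1.
have S0 : 0 < S by rewrite ltr_pwDl// sumr_ge0// => i _; rewrite invr_ge0 ltW.
exists S^-1 => [|x]; first by rewrite invr_gt0.
rewrite ler_pdivrMl//.
set Q := (X in _ <= _ * X).
have Q0 : 0 <= Q by exact: Ap.
rewrite mulrDl mul1r mulr_suml ler_wpDl//.
by apply: ler_sum => i _; rewrite ler_pdivlMl//; exact: sP.
Qed.

(** If all entries of Y - A are at most e in absolute value, then the form of
    Y - A is at least - e k |x|^2, which the coercivity of A absorbs for small
    e. *)
Lemma near_psdmx (R : realType) k (A : 'M[R]_k) :
  psdmx A -> A \in unitmx -> \forall Y \near A, Y^T = Y -> psdmx Y.
Proof.
move=> Ap Au; have [s s0 sP] := psdmx_coercive Ap Au.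
(* k.+1 rather than k: the size may be 0. *)
pose e : R := s / k.+1%:R.
have e0 : 0 < e by rewrite divr_gt0.
have : \forall Y \near A, forall i j,
      `|(Y : 'M[R]_k) i j - A i j| <= e.
  apply: (@filter_forall _ _ _ (nbhs A)) => i.
  apply: (@filter_forall _ _ _ (nbhs A)) => j.
  apply: (@cvgr_distC_le _ R^o _ (nbhs A) _ (fun Y : 'M[R]_k => Y i j)) => //.
  exact: coord_continuous.
apply: filterS => Y YA Ys; split=> // x.
rewrite -[Y](subrK A) mulmxDr mulmxDl mxE addrC.
apply: le_trans (_ : s * \sum_i x i ord0 ^+ 2 +
    - (e * k%:R * \sum_i x i ord0 ^+ 2) <= _).
  rewrite -mulrBl mulr_ge0 ?sumr_ge0// => [|i _]; last exact: sqr_ge0.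
  rewrite subr_ge0 /e mulrAC ler_pdivrMr// ler_wpM2l// ?ler_nat//.
  exact: ltW.
apply: lerD; first exact: sP.
rewrite quad_formE.
have -> : - (e * k%:R * \sum_i x i ord0 ^+ 2) =
    \sum_i \sum_j - (e * ((x i ord0 ^+ 2 + x j ord0 ^+ 2) / 2)).
  under [RHS]eq_bigr do
    rewrite sumrN -mulr_sumr -mulr_suml big_split /= sumr_const card_ord.
  rewrite sumrN -mulr_sumr -mulr_suml big_split /= sumr_const card_ord.
  rewrite sumrMnl -mulr_natr; congr (- _); set N := \sum_i _; lra.
apply: ler_sum => i _; apply: ler_sum => j _.
rewrite [(Y - A) i j]mxE [(- A) i j]mxE; have := YA i j.
set d := Y i j - _; set a := x i _; set b := x j _.
rewrite ler_norml => /andP[d1 d2].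
(* Half the sum of the two inequalities is e (a^2 + b^2) + 2 d a b >= 0. *)
have h1 : 0 <= (e + d) * (a + b) ^+ 2 by rewrite mulr_ge0 ?sqr_ge0//; lra.
have h2 : 0 <= (e - d) * (a - b) ^+ 2 by rewrite mulr_ge0 ?sqr_ge0//; lra.
nra.
Qed.

(** * Coordinates on symmetric matrices *)

Definition upair k := {u : 'I_k * 'I_k | (u.1 <= u.2)%N}.

Definition symdim k := #|{: upair k}|.

Lemma symdimE k : symdim k = 'C(k.+1, 2).
Proof.
rewrite /symdim card_sig -sum1_card.
transitivity (\sum_(j < k) \sum_(i < k | (i <= j)%N) 1)%N.
  by rewrite (exchange_big_dep xpredT) //= pair_big_dep.
rewrite -bin2_sum big_nat_recl// add0n big_mkord; apply: eq_bigr => j _.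
have := big_ord_narrow (op := addn) (idx := 0%N) (F := fun=> 1%N) (ltn_ord j).
by rewrite sum1_card [RHS]sum1_card card_ord -sum1_card.
Qed.

(** The entries are kept in {0, 1} so that the coordinates of a symmetric matrix
    are its own entries on and above the diagonal.  The price is that
    off-diagonal basis elements have squared norm 2 for the trace form, which is
    why its Gram matrix is carried along. *)
Definition symbase (R : realType) k (u : upair k) : 'M[R]_k :=
  \matrix_(a, b) (((a, b) == val u) || ((b, a) == val u))%:R.

Definition symmx (R : realType) k (v : 'rV[R]_(symdim k)) : 'M[R]_k :=
  \sum_s v ord0 s *: symbase R (enum_val s).

Definition symcoord (R : realType) k (X : 'M[R]_k) : 'rV[R]_(symdim k) :=
  \row_s X (val (enum_val s)).1 (val (enum_val s)).2.

Definition symgram (R : realType) k : 'M[R]_(symdim k) :=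
  \matrix_(s, t) \tr (symbase R (enum_val s) *m symbase R (enum_val t)).

Lemma symmx_sym (R : realType) k (v : 'rV[R]_(symdim k)) :
  (symmx v)^T = symmx v.
Proof.
apply/matrixP => a b; rewrite mxE !summxE; apply: eq_bigr => s _.
by rewrite !mxE orbC.
Qed.

Lemma symcoordK (R : realType) k (X : 'M[R]_k) :
  X^T = X -> symmx (symcoord X) = X.
Proof.
move=> Xs; apply/matrixP => a b.
wlog ab : a b / (a <= b)%N => [H|].
  have [|/ltnW ba] := leqP a b; first exact: H.
  by rewrite -[in LHS]symmx_sym -[in RHS]Xs !mxE H.
pose u : upair k := exist _ (a, b) ab.
rewrite summxE (bigD1 (enum_rank u)) //= big1 ?addr0 => [|s su].
  by rewrite !mxE enum_rankK eqxx mulr1.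
rewrite !mxE; case: eqP => [abs|_] /=.
  case/eqP: su; apply: enum_val_inj; rewrite enum_rankK.
  exact: val_inj.
case: eqP => [bas|_]; last by rewrite mulr0.
case/eqP: su; apply: enum_val_inj; rewrite enum_rankK; apply: val_inj => /=.
have ba : (b <= a)%N by case: (enum_val s) bas => -[c d] cd /= [-> ->].
have ab_eq : a = b by apply/val_inj/eqP; rewrite eqn_leq ab.
by rewrite -[LHS]bas ab_eq.
Qed.

Lemma tr_symmx_mul (R : realType) k (u v : 'rV[R]_(symdim k)) :
  \tr (symmx u *m symmx v) = (u *m symgram R k *m v^T) ord0 ord0.
Proof.
rewrite mxE mulmx_sumr raddf_sum /=; apply: eq_bigr => t _.
rewrite -scalemxAr mxtraceZ mulmx_suml raddf_sum /= !mxE mulrC mulr_suml.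
rewrite mulr_suml; apply: eq_bigr => s _.
by rewrite -scalemxAl mxtraceZ mxE.
Qed.

Lemma mx_symgramE (R : realType) p q k (U : 'M[R]_(p, symdim k))
    (V : 'M[R]_(q, symdim k)) i j :
  (U *m symgram R k *m V^T) i j = \tr (symmx (row i U) *m symmx (row j V)).
Proof.
rewrite tr_symmx_mul -row_mul [LHS]mxE [RHS]mxE.
apply: eq_bigr => t _.
by rewrite ![_^T _ _]mxE [row j V _ _]mxE [row i _ _ _]mxE.
Qed.

Lemma psd_factorization_gramE (R : realType) p q k (M : 'M[R]_(p, q))
    (A : 'I_p -> 'M[R]_k) (B : 'I_q -> 'M[R]_k) :
  psd_factorization M A B ->
  M = (\matrix_i symcoord (A i)) *m symgram R k *m (\matrix_j symcoord (B j))^T.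
Proof.
move=> [Apsd Bpsd MAB]; apply/matrixP => i j.
by rewrite mx_symgramE !rowK !symcoordK ?MAB//;
  [case: (Bpsd j) | case: (Apsd i)].
Qed.

(** The factorization passes through the space of symmetric matrices, of
    dimension 'C(k+1, 2). *)
Lemma psd_factorization_rank (R : realType) p q k (M : 'M[R]_(p, q)) :
  has_psd_factorization M k -> (\rank M <= 'C(k.+1, 2))%N.
Proof.
move=> [A [B /psd_factorization_gramE ->]]; rewrite -symdimE -mulmxA.
exact: leq_trans (mxrankM_maxl _ _) (rank_leq_col _).
Qed.

(** Turns the bound on the rank into a bound on the size. *)
Lemma leq_bin2_inj k m : ('C(k.+1, 2) <= 'C(m.+1, 2))%N -> (k <= m)%N.
Proof.
apply: contraTT; rewrite -!ltnNge => mk.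
have step : ('C(m.+1, 2) < 'C(m.+2, 2))%N.
  by rewrite [in X in (_ < X)%N]binS bin1 -addn1 leq_add2l.
exact: leq_trans step (leq_bin2l _ _).
Qed.

(** * Persistence of full-rank psd factorizations *)

(** Invertibility of D N C forces D N to have the same rank as N, hence the same
    row space; so N = X (D N) for some X, and multiplying by C on the right
    determines X. *)
Lemma mx_rank_sandwich (F : fieldType) p q r (N : 'M[F]_(p, q))
    (C : 'M[F]_(q, r)) (D : 'M[F]_(r, p)) :
  \rank N = r -> D *m N *m C \in unitmx ->
  N = N *m C *m invmx (D *m N *m C) *m (D *m N).
Proof.
move=> Nr DNCu.
have DN_rank : \rank (D *m N) = r.
  apply/eqP; rewrite eqn_leq rank_leq_row /=.
  by rewrite -[X in (X <= _)%N](mxrank_unit DNCu) mxrankM_maxl.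
have /submxP[X NX] : (N <= D *m N)%MS.
  by have [_ <-] := mxrank_leqif_sup (submxMl D N); rewrite DN_rank Nr.
have -> : N *m C = X *m (D *m N *m C) by rewrite {1}NX !mulmxA.
by rewrite mulmxK// -NX.
Qed.

Lemma cvg_symmx_row (R : realType) (T : Type) (F : set_system T) {FF : Filter F}
    p k (f : T -> 'M[R]_(p, symdim k)) (L : 'M[R]_(p, symdim k)) i :
  f @ F --> L -> symmx (row i (f x)) @[x --> F] --> symmx (row i L).
Proof.
move=> fL; apply: cvg_mx => a b; rewrite summxE.
under eq_fun do rewrite summxE.
apply: cvg_sum_fin => s; rewrite !mxE; under eq_fun do rewrite !mxE.
by apply: cvgM; [exact: cvg_entry | exact: cvg_cst].
Qed.

Lemma near_psdmx_rows (R : realType) (T : Type) (F : set_system T)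
    {FF : Filter F} p k (f : T -> 'M[R]_(p, symdim k))
    (L : 'M[R]_(p, symdim k)) :
  f @ F --> L ->
  (forall i, psdmx (symmx (row i L))) ->
  (forall i, symmx (row i L) \in unitmx) ->
  \forall x \near F, forall i, psdmx (symmx (row i (f x))).
Proof.
move=> fL Lpsd Lu; apply: filter_forall => i.
have := near_psdmx (Lpsd i) (Lu i) => /(cvg_symmx_row (i := i) fL).
rewrite /nbhs /= /nbhs /=.
by apply: filterS => x; apply; exact: symmx_sym.
Qed.

(** A factorization by invertible factors of a matrix of the largest possible
    rank survives every small perturbation which keeps that rank. *)
Lemma near_has_psd_factorization (R : realType) p q k (M : 'M[R]_(p, q))
    (A : 'I_p -> 'M[R]_k) (B : 'I_q -> 'M[R]_k) :
  psd_factorization M A B ->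
  (forall i, A i \in unitmx) -> (forall j, B j \in unitmx) ->
  \rank M = 'C(k.+1, 2) ->
  \forall N \near M, \rank N = 'C(k.+1, 2) -> has_psd_factorization N k.
Proof.
move=> ABM Au Bu; rewrite -symdimE => Mr; have [Apsd Bpsd _] := ABM.
set U : 'M[R]_(p, symdim k) := \matrix_i symcoord (A i).
set V : 'M[R]_(q, symdim k) := \matrix_j symcoord (B j).
have UA i : symmx (row i U) = A i by rewrite rowK symcoordK//; case: (Apsd i).
have VB j : symmx (row j V) = B j by rewrite rowK symcoordK//; case: (Bpsd j).
set G := symgram R k.
have MUGV : M = U *m G *m V^T by exact: psd_factorization_gramE.
(* The rank of M is the inner dimension of U G V^T, so each of the three
   matrices has full rank. *)
have Gu : G \in unitmx.
  rewrite -row_free_unit -row_leq_rank -[X in (X <= _)%N]Mr MUGV.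
  exact: leq_trans (mxrankM_maxl _ _) (mxrankM_maxr _ _).
have DU : pinvmx U *m U = 1%:M.
  apply: mulVpmx; rewrite -col_leq_rank -[X in (X <= _)%N]Mr MUGV -mulmxA.
  exact: mxrankM_maxl.
have GVC : G *m V^T *m pinvmx (G *m V^T) = 1%:M.
  apply: mulmxVp; rewrite -row_leq_rank -[X in (X <= _)%N]Mr MUGV -mulmxA.
  exact: mxrankM_maxr.
set D := pinvmx U in DU; set C := pinvmx _ in GVC.
have DM : D *m M = G *m V^T by rewrite MUGV !mulmxA DU mul1mx.
have MC : M *m C = U by rewrite MUGV -!mulmxA (mulmxA G) GVC mulmx1.
have DMC : D *m M *m C = 1%:M by rewrite DM.
(* Coordinates of the factors of N; they are U and V at N = M. *)
pose u (N : 'M[R]_(p, q)) := N *m C.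
pose v (N : 'M[R]_(p, q)) := (invmx G *m (invmx (D *m N *m C) *m (D *m N)))^T.
have cvg_DN : D *m N @[N --> M] --> D *m M.
  by apply: (@cvg_mulmx _ _ (nbhs M)); [exact: cvg_cst | exact: cvg_id].
have cvg_DNC : D *m N *m C @[N --> M] --> D *m M *m C.
  by apply: (@cvg_mulmx _ _ (nbhs M)) => //; exact: cvg_cst.
have DMCu : D *m M *m C \in unitmx by rewrite DMC unitmx1.
have uU : u @ M --> U.
  rewrite -MC; apply: (@cvg_mulmx _ _ (nbhs M)); first exact: cvg_id.
  exact: cvg_cst.
have vV : v @ M --> V.
  have -> : V = v M by rewrite /v DMC invmx1 mul1mx DM mulKmx ?trmxK.
  apply: (@cvg_trmx _ _ (nbhs M)); apply: (@cvg_mulmx _ _ (nbhs M)).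
    exact: cvg_cst.
  by apply: (@cvg_mulmx _ _ (nbhs M)) => //; exact: (@cvg_invmx _ _ (nbhs M)).
have near_A : \forall N \near M, forall i, psdmx (symmx (row i (u N))).
  by apply: (near_psdmx_rows uU) => i; rewrite UA.
have near_B : \forall N \near M, forall j, psdmx (symmx (row j (v N))).
  by apply: (near_psdmx_rows vV) => j; rewrite VB.
have near_u : \forall N \near M, D *m N *m C \in unitmx.
  exact: near_unitmx cvg_DNC DMCu.
apply: (@filterS3 _ (nbhs M) _ _ _ _ _ _ near_A near_B near_u) =>
  N NA NB Nu Nr.
exists (fun i => symmx (row i (u N))), (fun j => symmx (row j (v N))).
split=> // i j; rewrite -mx_symgramE trmxK.
by rewrite -[u N *m G *m _]mulmxA mulKVmx// mulmxA -mx_rank_sandwich.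
Qed.

(** * Boundary points *)

Theorem proposition11 (R : realType) (p q k : nat) (M : 'M[R]_(p, q))
    (M_pos : forall i j, 0 < M i j)
    (M_bd : boundary_within (rank_set R p q 'C(k.+1, 2))
                            (psd_rank_set R p q 'C(k.+1, 2) k) M)
    (A : 'I_p -> 'M[R]_k) (B : 'I_q -> 'M[R]_k)
    (AB_fact : psd_factorization M A B) :
  (exists i : 'I_p, (\rank (A i) < k)%N) \/
  (exists j : 'I_q, (\rank (B j) < k)%N).
Proof.
set r := 'C(k.+1, 2) in M_bd.
set X := rank_set R p q r in M_bd; set S := psd_rank_set R p q r k in M_bd.
have [cl_M int_M] := M_bd.
apply: contrapT => /not_orP[/forallNP Afull /forallNP Bfull]; apply: int_M.
have full_unit (Y : 'M[R]_k) : ~ (\rank Y < k)%N -> Y \in unitmx.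
  by move=> /negP; rewrite -leqNgt row_leq_rank row_free_unit.
have MX : X M.
  apply: contrapT => MX.
  (* Off X the subspace topology is discrete, so a closure point lies in S,
     which is contained in X. *)
  have M_isolated : nbhs_subspace (M : subspace X) [set M].
    by rewrite -nbhs_subspace_out.
  by have [N [[_ NX _] NM]] := cl_M _ M_isolated; apply: MX; rewrite -NM.
change (nbhs_subspace (M : subspace X) S); rewrite -nbhs_subspace_in//.
have near_fact := near_has_psd_factorization AB_fact
  (fun i => full_unit _ (Afull i)) (fun j => full_unit _ (Bfull j)) MX.
have near_pos : \forall N \near M, forall i j, 0 < (N : 'M[R]_(p, q)) i j.
  apply: (@filter_forall _ _ _ (nbhs M)) => i.
  apply: (@filter_forall _ _ _ (nbhs M)) => j.
  exact: (cvgr_gt (M i j) (@coord_continuous _ _ _ i j M)).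
apply: (@filterS2 _ (nbhs M) _ _ _ _ _ near_fact near_pos) => N N_fact N_pos NX.
split=> [i j||]; [exact: ltW | exact: NX |].
split=> [|m /psd_factorization_rank]; first exact: N_fact.
by rewrite NX => /leq_bin2_inj.
Qed.
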